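(* Let $\mathfrak{c}=(A,c,\Delta_c,\varepsilon_c)$ and $\mathfrak{d}=(B,d,\Delta_d,\varepsilon_d)$ be comonads in a 2-category $\mathcal{B}$, let $\Omega$ be a 0-cell of $\mathcal{B}$, and let $(p,q):\mathfrak{d}\to\mathfrak{c}$ be a comonad-morphism with adjunction such that $\mathrm{Rcom}(\Omega,\mathfrak{d})$ satisfies the equalizer condition for $p$. Suppose there are categories $\mathcal{X},\mathcal{Y}$ and functors $H:\mathrm{Rcom}(\Omega,\mathfrak{d})\to\mathcal{X}$, $H':\mathrm{Hom}(\Omega,A)\to\mathcal{Y}$ and $\mathscr{Q}':\mathcal{X}\to\mathcal{Y}$ such that $$\mathscr{Q}'\circ H=H'\circ U_{\Omega,\mathfrak{c}}\circ\mathscr{Q}=H'\circ(-\bullet q)\circ U_{\Omega,\mathfrak{d}},$$ where $U_{\Omega,\mathfrak{c}}:\mathrm{Rcom}(\Omega,\mathfrak{c})\to\mathrm{Hom}(\Omega,A)$ and $U_{\Omega,\mathfrak{d}}:\mathrm{Rcom}(\Omega,\mathfrak{d})\to\mathrm{Hom}(\Omega,B)$ are the forgetful functors. (1) The pullback functor $\mathscr{P}$ is fully faithful if the following conditions hold: (i) $\underline{\mathrm{can}}$ is an isomorphism; (ii) the composite functor $(-\bullet q)\circ U_{\Omega,\mathfrak{d}}$ is $H$-separable; (iii) $H$ preserves the equalizers $n\bullet^c(p\bullet d)\to n\bullet p\bullet d\rightrightarrows n\bullet c\bullet p\bullet d$ for $n\in\mathrm{Rcom}(\Omega,\mathfrak{c})$;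 (iv) $H'$ reflects isomorphisms. (2) The pushout functor $\mathscr{Q}$ is fully faithful, and therefore $(\mathscr{Q},\mathscr{P})$ is an equivalence of categories, if in addition to the conditions in (1) the following conditions hold: (i) $\overline{\mathrm{can}}$ is an isomorphism; (ii) $H$ reflects isomorphisms.
   Context: $\mathcal{B}$ is a (strict) 2-category. $\mathrm{Hom}(A,B)$ is the category of 1-cells $A\to B$ and 2-cells between them; vertical composition is $\circ$. The composite of $f:A\to B$ and $g:B\to C$ is written $f\bullet g:A\to C$ (diagrammatic order), and $\bullet$ also denotes horizontal composition of 2-cells; the identity 2-cell of $f$ is written $f$ and the identity 1-cell of $A$ is written $A$. A comonad $\mathfrak{c}=(A,c,\Delta_c,\varepsilon_c)$: a 1-cell $c:A\to A$ with 2-cells $\Delta_c:c\to c\bullet c$, $\varepsilon_c:c\to A$, coassociative and counital. For a 0-cell $\Omega$, $\mathrm{Rcom}(\Omega,\mathfrak{c})$ has objects $(m,\rho^m)$ with $m:\Omega\to A$ a 1-cell and $\rho^m:m\to m\bullet c$ satisfying $(\rho^m\bullet c)\circ\rho^m=(m\bullet\Delta_c)\circ\rho^m$, $(m\bullet\varepsilon_c)\circ\rho^m=m$; morphisms are 2-cells $\psi:m\to n$ with $\rho^n\circ\psi=(\psi\bullet c)\circ\rho^m$. A comonad-morphism with adjunction $(p,q):\mathfrak{d}\to\mathfrak{c}$ consists of 1-cells $p:A\to B$, $q:B\to A$ and 2-cells $\mu:p\bullet q\to A$, $\eta:B\to q\bullet p$ with $(q\bullet\mu)\circ(\eta\bullet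 q)=q$ and $(\mu\bullet p)\circ(p\bullet\eta)=p$, together with a 2-cell $\alpha:d\bullet q\to q\bullet c$ such that $(q\bullet\Delta_c)\circ\alpha=(\alpha\bullet c)\circ(d\bullet\alpha)\circ(\Delta_d\bullet q)$ and $(q\bullet\varepsilon_c)\circ\alpha=\varepsilon_d\bullet q$. Put $\underline{\mathrm{can}}=(\mu\bullet c)\circ(p\bullet\alpha):p\bullet d\bullet q\to c$, $\beta=(\underline{\mathrm{can}}\bullet p)\circ(p\bullet d\bullet\eta)$, $\lambda^{p\bullet d}=(\beta\bullet d)\circ(p\bullet\Delta_d):p\bullet d\to c\bullet p\bullet d$ and $\rho^{d\bullet q}=(d\bullet\alpha)\circ(\Delta_d\bullet q):d\bullet q\to d\bullet q\bullet c$. Pushout functor $\mathscr{Q}:\mathrm{Rcom}(\Omega,\mathfrak{d})\to\mathrm{Rcom}(\Omega,\mathfrak{c})$: $\mathscr{Q}(x,\rho)=(x\bullet q,(x\bullet\alpha)\circ(\rho\bullet q))$, $\mathscr{Q}(\phi)=\phi\bullet q$. Equalizer condition for $p$: for every $(n,\rho)\in\mathrm{Rcom}(\Omega,\mathfrak{c})$, the pair $\rho\bullet p\bullet d,\ n\bullet\lambda^{p\bullet d}:n\bullet p\bullet d\rightrightarrows n\bullet c\bullet p\bullet d$ (with right $\mathfrak{d}$-coactions $n\bullet p\bullet\Delta_d$ and $n\bullet c\bullet p\bullet\Delta_d$) has an equalizer $n\bullet^c(p\bullet d)\to n\bullet p\bullet d$ in $\mathrm{Rcom}(\Omega,\mathfrak{d})$.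 The pullback functor $\mathscr{P}:\mathrm{Rcom}(\Omega,\mathfrak{c})\to\mathrm{Rcom}(\Omega,\mathfrak{d})$ is $\mathscr{P}(n)=n\bullet^c(p\bullet d)$; it is right adjoint to $\mathscr{Q}$. The 2-cell $(d\bullet\eta\bullet d)\circ\Delta_d:d\to d\bullet q\bullet p\bullet d$ equalizes $\rho^{d\bullet q}\bullet p\bullet d$ and $d\bullet q\bullet\lambda^{p\bullet d}$. When the equalizer $(d\bullet q)\bullet^c(p\bullet d)$ of these two 2-cells exists in $\mathrm{Hom}(B,B)$, $\overline{\mathrm{can}}:d\to(d\bullet q)\bullet^c(p\bullet d)$ is the induced 2-cell; the condition ''$\overline{\mathrm{can}}$ is an isomorphism'' includes the existence of this equalizer. $H$-separability: a functor $F:\mathcal{V}\to\mathcal{W}$ with right adjoint $G$ and unit $\theta:1\to GF$ is $H$-separable, for a functor $H:\mathcal{V}\to\mathcal{X}$, if there is a natural transformation $\xi:HGF\to H$ with $\xi\circ H\theta=\mathrm{id}_H$. The functor $(-\bullet q)\circ U_{\Omega,\mathfrak{d}}$ has right adjoint $-\bullet p\bullet d$, with unit $(m\bullet\eta\bullet d)\circ\rho^m:m\to m\bullet q\bullet p\bullet d$. *)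

(* Defs.v *)
From Stdlib Require Import ProofIrrelevance IndefiniteDescription.

Set Implicit Arguments.
Unset Strict Implicit.
Unset Printing Implicit Defensive.

Declare Scope cat_scope.
Delimit Scope cat_scope with cat.
Local Open Scope cat_scope.

Record Category := {
  ob :> Type;
  hom : ob -> ob -> Type;
  idm : forall x, hom x x;
  comp : forall x y z, hom y z -> hom x y -> hom x z;
  comp_idl : forall x y (f : hom x y), comp (idm y) f = f;
  comp_idr : forall x y (f : hom x y), comp f (idm x) = f;
  comp_assoc : forall x y z t (h : hom z t) (g : hom y z) (f : hom x y),
    comp (comp h g) f = comp h (comp g f)
}.
Arguments hom {c} _ _.
Arguments idm {c} _.
Arguments comp {c x y z} _ _.
Arguments comp_idl {c x y} _.
Arguments comp_idr {c x y} _.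
Arguments comp_assoc {c x y z t} _ _ _.

Notation "x ⇒ y" := (hom x y) (at level 70, no associativity) : cat_scope.
Notation "g ∘ f" := (comp g f) (at level 40, left associativity) : cat_scope.

Definition is_iso {C : Category} {x y : C} (f : x ⇒ y) : Prop :=
  exists g : y ⇒ x, g ∘ f = idm x /\ f ∘ g = idm y.

(** The identity morphism, seen as a morphism between equal objects. *)
Definition idto {C : Category} {x y : C} (e : x = y) : x ⇒ y :=
  match e in _ = z return x ⇒ z with eq_refl => idm x end.

Record Functor (C D : Category) := {
  fobj :> C -> D;
  fmap : forall x y, x ⇒ y -> fobj x ⇒ fobj y;
  fmap_id : forall x, fmap (idm x) = idm (fobj x);
  fmap_comp : forall x y z (g : y ⇒ z) (f : x ⇒ y),
    fmap (g ∘ f) = fmap g ∘ fmap f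
}.
Arguments fmap {C D} _ {x y} _.
Arguments fmap_id {C D} _ _.
Arguments fmap_comp {C D} _ {x y z} _ _.

Definition functor_id (C : Category) : Functor C C :=
  {| fobj := fun x => x;
     fmap := fun x y f => f;
     fmap_id := fun x => eq_refl;
     fmap_comp := fun x y z g f => eq_refl |}.

Definition functor_comp (C D E : Category) (G : Functor D E) (F : Functor C D)
  : Functor C E :=
  {| fobj := fun x => G (F x);
     fmap := fun x y f => fmap G (fmap F f);
     fmap_id := fun x => eq_trans (f_equal _ (fmap_id F x)) (fmap_id G (F x));
     fmap_comp := fun x y z g f =>
       eq_trans (f_equal _ (fmap_comp F g f))
                (fmap_comp G (fmap F g) (fmap F f)) |}.

Notation "G ∘F F" := (functor_comp G F) (at level 40, left associativity)
  : cat_scope.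

Record NatTrans (C D : Category) (F G : Functor C D) := {
  nt_app :> forall x, F x ⇒ G x;
  nt_natural : forall x y (f : x ⇒ y),
    nt_app y ∘ fmap F f = fmap G f ∘ nt_app x
}.

Record Adjunction (C D : Category) (F : Functor C D) (G : Functor D C) := {
  adj_unit : NatTrans (functor_id C) (G ∘F F);
  adj_counit : NatTrans (F ∘F G) (functor_id D);
  adj_triangle_left : forall x,
    adj_counit (F x) ∘ fmap F (adj_unit x) = idm (F x);
  adj_triangle_right : forall y,
    fmap G (adj_counit y) ∘ adj_unit (G y) = idm (G y)
}.

Definition fully_faithful (C D : Category) (F : Functor C D) : Prop :=
  forall (x y : C) (g : F x ⇒ F y), exists! f : x ⇒ y, fmap F f = g.

Definition reflects_isos (C D : Category) (F : Functor C D) : Prop :=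
  forall (x y : C) (f : x ⇒ y), is_iso (fmap F f) -> is_iso f.

(** [F] and [G] are mutually quasi-inverse, by means of an adjunction whose
    unit and counit are isomorphisms. *)
Definition adjoint_equivalence (C D : Category)
    (F : Functor C D) (G : Functor D C) : Prop :=
  exists adj : Adjunction F G,
    (forall x, is_iso (adj_unit adj x)) /\ (forall y, is_iso (adj_counit adj y)).

Definition h_separable (V W X : Category) (F : Functor V W) (G : Functor W V)
    (adj : Adjunction F G) (H : Functor V X) : Prop :=
  exists xi : NatTrans (H ∘F (G ∘F F)) H,
    forall v, xi v ∘ fmap H (adj_unit adj v) = idm (H v).

Definition is_equalizer {C : Category} {e y z : C}
    (f g : y ⇒ z) (i : e ⇒ y) : Prop :=
  f ∘ i = g ∘ i /\
  forall (w : C) (h : w ⇒ y), f ∘ h = g ∘ h -> exists! u : w ⇒ e, i ∘ u = h.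

Record Equalizer {C : Category} {y z : C} (f g : y ⇒ z) := {
  equ_ob : C;
  equ_arr : equ_ob ⇒ y;
  equ_is_equalizer : is_equalizer f g equ_arr
}.

Definition equ_lift {C : Category} {y z : C} {f g : y ⇒ z}
    (E : Equalizer f g) (w : C) (h : w ⇒ y) (hfg : f ∘ h = g ∘ h)
  : w ⇒ equ_ob E :=
  proj1_sig (constructive_indefinite_description _
    (proj2 (equ_is_equalizer E) w h hfg)).

Lemma equ_lift_arr {C : Category} {y z : C} {f g : y ⇒ z}
    (E : Equalizer f g) (w : C) (h : w ⇒ y) (hfg : f ∘ h = g ∘ h) :
  equ_arr E ∘ equ_lift E hfg = h.
Proof.
  unfold equ_lift.
  destruct (constructive_indefinite_description _ _) as [u [Hu Hu']].
  exact Hu.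
Qed.

Lemma equ_arr_mono {C : Category} {y z : C} {f g : y ⇒ z}
    (E : Equalizer f g) (w : C) (u v : w ⇒ equ_ob E) :
  equ_arr E ∘ u = equ_arr E ∘ v -> u = v.
Proof.
  intros Huv.
  destruct (equ_is_equalizer E) as [Hfg Hex].
  assert (hfg : f ∘ (equ_arr E ∘ u) = g ∘ (equ_arr E ∘ u))
    by (rewrite <- !comp_assoc, Hfg; reflexivity).
  destruct (Hex w (equ_arr E ∘ u) hfg) as [t [_ Ht]].
  rewrite <- (Ht u eq_refl). apply Ht. symmetry; exact Huv.
Qed.

(** The composition of 1-cells, in diagrammatic order, is associative and unital
    up to Leibniz equality.  As this equality is not definitional, the strictness
    axioms for 2-cells use the identity 2-cells [idto] between equal 1-cells. *)
Record TwoCategory := {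
  cell0 :> Type;
  Hom : cell0 -> cell0 -> Category;
  id1 : forall A, Hom A A;
  comp1 : forall A B C, Hom A B -> Hom B C -> Hom A C;
  hcomp : forall A B C (f f' : Hom A B) (g g' : Hom B C),
    f ⇒ f' -> g ⇒ g' -> comp1 f g ⇒ comp1 f' g';
  hcomp_id : forall A B C (f : Hom A B) (g : Hom B C),
    hcomp (idm f) (idm g) = idm (comp1 f g);
  hcomp_comp : forall A B C (f f' f'' : Hom A B) (g g' g'' : Hom B C)
      (φ' : f' ⇒ f'') (φ : f ⇒ f') (ψ' : g' ⇒ g'') (ψ : g ⇒ g'),
    hcomp (φ' ∘ φ) (ψ' ∘ ψ) = hcomp φ' ψ' ∘ hcomp φ ψ;
  comp1_assoc : forall A B C D (f : Hom A B) (g : Hom B C) (h : Hom C D),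
    comp1 (comp1 f g) h = comp1 f (comp1 g h);
  comp1_idl : forall A B (f : Hom A B), comp1 (id1 A) f = f;
  comp1_idr : forall A B (f : Hom A B), comp1 f (id1 B) = f;
  hcomp_assoc : forall A B C D (f f' : Hom A B) (g g' : Hom B C) (h h' : Hom C D)
      (φ : f ⇒ f') (ψ : g ⇒ g') (χ : h ⇒ h'),
    idto (comp1_assoc f' g' h') ∘ hcomp (hcomp φ ψ) χ
    = hcomp φ (hcomp ψ χ) ∘ idto (comp1_assoc f g h);
  hcomp_idl : forall A B (f f' : Hom A B) (φ : f ⇒ f'),
    idto (comp1_idl f') ∘ hcomp (idm (id1 A)) φ = φ ∘ idto (comp1_idl f);
  hcomp_idr : forall A B (f f' : Hom A B) (φ : f ⇒ f'),
    idto (comp1_idr f') ∘ hcomp φ (idm (id1 B)) = φ ∘ idto (comp1_idr f)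
}.
Arguments Hom {t} _ _.
Arguments id1 {t} _.
Arguments comp1 {t A B C} _ _.
Arguments hcomp {t A B C f f' g g'} _ _.
Arguments hcomp_id {t A B C} _ _.
Arguments hcomp_comp {t A B C f f' f'' g g' g''} _ _ _ _.
Arguments comp1_assoc {t A B C D} _ _ _.
Arguments comp1_idl {t A B} _.
Arguments comp1_idr {t A B} _.
Arguments hcomp_assoc {t A B C D f f' g g' h h'} _ _ _.
Arguments hcomp_idl {t A B f f'} _.
Arguments hcomp_idr {t A B f f'} _.

Notation "f • g" := (comp1 f g) (at level 32, left associativity) : cat_scope.
Notation "m ◁ φ" := (hcomp (idm m) φ) (at level 33, no associativity) : cat_scope.
Notation "φ ▷ m" := (hcomp φ (idm m)) (at level 34, left associativity) : cat_scope.

Definition asr {K : TwoCategory} {A B C D : K}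
    (f : Hom A B) (g : Hom B C) (h : Hom C D) : (f • g) • h ⇒ f • (g • h) :=
  idto (comp1_assoc f g h).
Definition asl {K : TwoCategory} {A B C D : K}
    (f : Hom A B) (g : Hom B C) (h : Hom C D) : f • (g • h) ⇒ (f • g) • h :=
  idto (eq_sym (comp1_assoc f g h)).
Definition lun {K : TwoCategory} {A B : K} (f : Hom A B) : id1 A • f ⇒ f :=
  idto (comp1_idl f).
Definition lun' {K : TwoCategory} {A B : K} (f : Hom A B) : f ⇒ id1 A • f :=
  idto (eq_sym (comp1_idl f)).
Definition run {K : TwoCategory} {A B : K} (f : Hom A B) : f • id1 B ⇒ f :=
  idto (comp1_idr f).
Definition run' {K : TwoCategory} {A B : K} (f : Hom A B) : f ⇒ f • id1 B :=
  idto (eq_sym (comp1_idr f)).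

(** For [φ] from a composite of [j] 1-cells to a composite of [k] 1-cells,
    [whiskjk m φ] is the 2-cell [m • φ] with source and target bracketed to the
    left.  All the composites of 1-cells below are bracketed this way, so that the
    strictness identities are not needed in the formulas. *)
Definition whisk10 {K : TwoCategory} {A B : K} (m : Hom A B)
    {f : Hom B B} (φ : f ⇒ id1 B) : m • f ⇒ m :=
  run m ∘ (m ◁ φ).
Definition whisk02 {K : TwoCategory} {A B C : K} (m : Hom A B)
    {g : Hom B C} {h : Hom C B} (φ : id1 B ⇒ g • h) : m ⇒ m • g • h :=
  asl m g h ∘ (m ◁ φ) ∘ run' m.
Definition whisk20 {K : TwoCategory} {A B C : K} (m : Hom A B)
    {g : Hom B C} {h : Hom C B} (φ : g • h ⇒ id1 B) : m • g • h ⇒ m :=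
  run m ∘ (m ◁ φ) ∘ asr m g h.
Definition whisk12 {K : TwoCategory} {A B C D : K} (m : Hom A B)
    {f : Hom B D} {g : Hom B C} {h : Hom C D} (φ : f ⇒ g • h)
  : m • f ⇒ m • g • h :=
  asl m g h ∘ (m ◁ φ).
Definition whisk22 {K : TwoCategory} {A B C C' D : K} (m : Hom A B)
    {f : Hom B C'} {f' : Hom C' D} {g : Hom B C} {h : Hom C D}
    (φ : f • f' ⇒ g • h) : m • f • f' ⇒ m • g • h :=
  asl m g h ∘ (m ◁ φ) ∘ asr m f f'.
Definition whisk31 {K : TwoCategory} {A B C C' D : K} (m : Hom A B)
    {f : Hom B C} {f' : Hom C C'} {f'' : Hom C' D} {g : Hom B D}
    (φ : f • f' • f'' ⇒ g) : m • f • f' • f'' ⇒ m • g :=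
  (m ◁ φ) ∘ asr m (f • f') f'' ∘ (asr m f f' ▷ f'').
Definition whisk23 {K : TwoCategory} {A B C C' D D' : K} (m : Hom A B)
    {f : Hom B C'} {f' : Hom C' D} {g : Hom B C} {h : Hom C D'} {k : Hom D' D}
    (φ : f • f' ⇒ g • h • k) : m • f • f' ⇒ m • g • h • k :=
  (asl m g h ▷ k) ∘ asl m (g • h) k ∘ (m ◁ φ) ∘ asr m f f'.

Record Comonad {K : TwoCategory} (A : K) := {
  cmd_cell :> Hom A A;
  cmd_delta : cmd_cell ⇒ cmd_cell • cmd_cell;
  cmd_eps : cmd_cell ⇒ id1 A;
  cmd_coassoc :
    (cmd_delta ▷ cmd_cell) ∘ cmd_delta = whisk12 cmd_cell cmd_delta ∘ cmd_delta;
  cmd_counit_left :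
    lun cmd_cell ∘ (cmd_eps ▷ cmd_cell) ∘ cmd_delta = idm cmd_cell;
  cmd_counit_right : whisk10 cmd_cell cmd_eps ∘ cmd_delta = idm cmd_cell
}.
Arguments cmd_delta {K A} _.
Arguments cmd_eps {K A} _.

Record Comodule {K : TwoCategory} (Ω : K) {A : K} (c : Comonad A) := {
  cmod_cell :> Hom Ω A;
  cmod_coact : cmod_cell ⇒ cmod_cell • c;
  cmod_coassoc :
    (cmod_coact ▷ c) ∘ cmod_coact = whisk12 cmod_cell (cmd_delta c) ∘ cmod_coact;
  cmod_counit : whisk10 cmod_cell (cmd_eps c) ∘ cmod_coact = idm cmod_cell
}.
Arguments cmod_coact {K Ω A c} _.
Arguments cmod_coassoc {K Ω A c} _.
Arguments cmod_counit {K Ω A c} _.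

Definition ComoduleHom {K : TwoCategory} {Ω A : K} {c : Comonad A}
    (m n : Comodule Ω c) : Type :=
  {ψ : cmod_cell m ⇒ cmod_cell n | cmod_coact n ∘ ψ = (ψ ▷ c) ∘ cmod_coact m}.

Record ComonadMorphAdj {K : TwoCategory} {A B : K} (d : Comonad B) (c : Comonad A)
  := {
  cma_p : Hom A B;
  cma_q : Hom B A;
  cma_mu : cma_p • cma_q ⇒ id1 A;
  cma_eta : id1 B ⇒ cma_q • cma_p;
  cma_zigzag_q :
    whisk20 cma_q cma_mu ∘ (cma_eta ▷ cma_q) ∘ lun' cma_q = idm cma_q;
  cma_zigzag_p :
    lun cma_p ∘ (cma_mu ▷ cma_p) ∘ whisk02 cma_p cma_eta = idm cma_p;
  cma_alpha : d • cma_q ⇒ cma_q • c;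
  cma_alpha_delta :
    whisk12 cma_q (cmd_delta c) ∘ cma_alpha
    = (cma_alpha ▷ c) ∘ whisk22 d cma_alpha ∘ (cmd_delta d ▷ cma_q);
  cma_alpha_eps :
    whisk10 cma_q (cmd_eps c) ∘ cma_alpha = lun cma_q ∘ (cmd_eps d ▷ cma_q)
}.
Arguments cma_p {K A B d c} _.
Arguments cma_q {K A B d c} _.
Arguments cma_mu {K A B d c} _.
Arguments cma_eta {K A B d c} _.
Arguments cma_alpha {K A B d c} _.

Section Cells.

Context {K : TwoCategory} {A B : K} {d : Comonad B} {c : Comonad A}.
Context (pq : ComonadMorphAdj d c).

Let p := cma_p pq.
Let q := cma_q pq.

Definition can_cell : p • d • q ⇒ c :=
  lun c ∘ (cma_mu pq ▷ c) ∘ whisk22 p (cma_alpha pq).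

Definition beta_cell : p • d ⇒ c • p :=
  (can_cell ▷ p) ∘ whisk02 (p • d) (cma_eta pq).

Definition lambda_cell : p • d ⇒ c • p • d :=
  (beta_cell ▷ d) ∘ whisk12 p (cmd_delta d).

End Cells.

Section StrictEq.

Definition eqv {C : Category} {x y x' y' : C} (f : x ⇒ y) (g : x' ⇒ y') : Prop :=
  exists (ex : x = x') (ey : y = y'), idto ey ∘ f = g ∘ idto ex.

Lemma eqv_eq (C : Category) (x y : C) (f g : x ⇒ y) : eqv f g -> f = g.
Proof.
  intros [ex [ey H]].
  rewrite (proof_irrelevance _ ex eq_refl), (proof_irrelevance _ ey eq_refl) in H.
  simpl in H. rewrite comp_idl, comp_idr in H. exact H.
Qed.

Lemma eqv_refl (C : Category) (x y : C) (f : x ⇒ y) : eqv f f.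
Proof. exists eq_refl, eq_refl; simpl; now rewrite comp_idl, comp_idr. Qed.

Lemma eqv_sym (C : Category) (x y x' y' : C) (f : x ⇒ y) (g : x' ⇒ y') :
  eqv f g -> eqv g f.
Proof.
  intros [ex [ey H]]; subst; simpl in H. rewrite comp_idl, comp_idr in H.
  subst; apply eqv_refl.
Qed.

Lemma eqv_trans (C : Category) (x y x' y' x'' y'' : C)
    (g : x' ⇒ y') (f : x ⇒ y) (h : x'' ⇒ y'') :
  eqv f g -> eqv g h -> eqv f h.
Proof.
  intros [ex [ey H]]; subst; simpl in H. rewrite comp_idl, comp_idr in H.
  subst; auto.
Qed.

Lemma eqv_comp (C : Category) (x y z x' y' z' : C)
    (g : y ⇒ z) (f : x ⇒ y) (g' : y' ⇒ z') (f' : x' ⇒ y') :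
  eqv g g' -> eqv f f' -> eqv (g ∘ f) (g' ∘ f').
Proof.
  intros Hg [ex [ey Hf]]; subst; simpl in Hf. rewrite comp_idl, comp_idr in Hf.
  subst. destruct Hg as [ey [ez Hg]]; subst; simpl in Hg.
  rewrite (proof_irrelevance _ ey eq_refl) in Hg; simpl in Hg.
  rewrite comp_idl, comp_idr in Hg. subst; apply eqv_refl.
Qed.

Lemma eqv_idto_l (C : Category) (x y z x' z' : C)
    (e : y = z) (f : x ⇒ y) (g : x' ⇒ z') :
  eqv f g -> eqv (idto e ∘ f) g.
Proof. subst; simpl; now rewrite comp_idl. Qed.

Lemma eqv_idto_r (C : Category) (x y z x' z' : C)
    (e : x = y) (f : y ⇒ z) (g : x' ⇒ z') :
  eqv f g -> eqv (f ∘ idto e) g.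
Proof. subst; simpl; now rewrite comp_idr. Qed.

Lemma eqv_id_l (C : Category) (x y z t x' z' : C)
    (g : y ⇒ z) (f : x ⇒ y) (f' : x' ⇒ z') :
  eqv g (idm t) -> eqv f f' -> eqv (g ∘ f) f'.
Proof.
  intros [e1 [e2 H]]; subst; simpl in H. rewrite comp_idl, comp_idl in H.
  subst; now rewrite comp_idl.
Qed.

Lemma eqv_id_r (C : Category) (x y z t x' z' : C)
    (f : y ⇒ z) (g : x ⇒ y) (f' : x' ⇒ z') :
  eqv g (idm t) -> eqv f f' -> eqv (f ∘ g) f'.
Proof.
  intros [e1 [e2 H]]; subst; simpl in H. rewrite comp_idl, comp_idl in H.
  subst; now rewrite comp_idr.
Qed.

Context {K : TwoCategory}.

Lemma eqv_hcomp (A B C : K) (f f' g g' : Hom A B) (h h' k k' : Hom B C)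
    (φ : f ⇒ f') (ψ : g ⇒ g') (φ' : h ⇒ h') (ψ' : k ⇒ k') :
  eqv φ ψ -> eqv φ' ψ' -> eqv (hcomp φ φ') (hcomp ψ ψ').
Proof.
  intros [e1 [e2 H]] [e3 [e4 H']]; subst; simpl in *.
  rewrite comp_idl, comp_idr in H; rewrite comp_idl, comp_idr in H'.
  subst; apply eqv_refl.
Qed.

Lemma eqv_hcomp_assoc (A B C D : K) (f f' : Hom A B) (g g' : Hom B C)
    (h h' : Hom C D) (φ : f ⇒ f') (ψ : g ⇒ g') (χ : h ⇒ h') :
  eqv (hcomp (hcomp φ ψ) χ) (hcomp φ (hcomp ψ χ)).
Proof. exists (comp1_assoc f g h), (comp1_assoc f' g' h'). apply hcomp_assoc. Qed.

Lemma eqv_hcomp_idl (A B : K) (f f' : Hom A B) (φ : f ⇒ f') :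
  eqv (hcomp (idm (id1 A)) φ) φ.
Proof. exists (comp1_idl f), (comp1_idl f'). apply hcomp_idl. Qed.

Lemma eqv_hcomp_idr (A B : K) (f f' : Hom A B) (φ : f ⇒ f') :
  eqv (hcomp φ (idm (id1 B))) φ.
Proof. exists (comp1_idr f), (comp1_idr f'). apply hcomp_idr. Qed.

Lemma eqv_wl (A B C : K) (m : Hom A B) (f f' g g' : Hom B C)
    (φ : f ⇒ f') (ψ : g ⇒ g') :
  eqv φ ψ -> eqv (m ◁ φ) (m ◁ ψ).
Proof. intros H; apply eqv_hcomp; [apply eqv_refl | exact H]. Qed.

Lemma eqv_wr (A B C : K) (m : Hom B C) (f f' g g' : Hom A B)
    (φ : f ⇒ f') (ψ : g ⇒ g') :
  eqv φ ψ -> eqv (φ ▷ m) (ψ ▷ m).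
Proof. intros H; apply eqv_hcomp; [exact H | apply eqv_refl]. Qed.

Lemma eqv_wl_comp1 (A B C D : K) (m : Hom A B) (n : Hom B C) (f f' : Hom C D)
    (φ : f ⇒ f') :
  eqv (m • n ◁ φ) (m ◁ (n ◁ φ)).
Proof. rewrite <- hcomp_id. apply eqv_hcomp_assoc. Qed.

Lemma eqv_wr_id (A B C : K) (f g : Hom A B) (h : Hom B C) (e : f = g) :
  eqv (idto e ▷ h) (idm (f • h)).
Proof. subst; simpl; rewrite hcomp_id; apply eqv_refl. Qed.

Lemma wl_comp (A B C : K) (m : Hom A B) (f g h : Hom B C)
    (ψ : g ⇒ h) (φ : f ⇒ g) :
  m ◁ (ψ ∘ φ) = (m ◁ ψ) ∘ (m ◁ φ).
Proof. now rewrite <- hcomp_comp, comp_idl. Qed.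

Lemma wr_comp (A B C : K) (m : Hom B C) (f g h : Hom A B)
    (ψ : g ⇒ h) (φ : f ⇒ g) :
  (ψ ∘ φ) ▷ m = (ψ ▷ m) ∘ (φ ▷ m).
Proof. now rewrite <- hcomp_comp, comp_idl. Qed.

Lemma interchange (A B C : K) (m n : Hom A B) (f g : Hom B C)
    (u : m ⇒ n) (φ : f ⇒ g) :
  (n ◁ φ) ∘ (u ▷ f) = (u ▷ g) ∘ (m ◁ φ).
Proof. now rewrite <- !hcomp_comp, !comp_idl, !comp_idr. Qed.

Lemma eqv_wr_comp1 (A B C D : K) (m : Hom B C) (n : Hom C D) (f f' : Hom A B)
    (φ : f ⇒ f') :
  eqv (φ ▷ m ▷ n) (φ ▷ (m • n)).
Proof. rewrite <- hcomp_id. apply eqv_hcomp_assoc. Qed.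

Lemma eqv_wl_wr (A B C D : K) (m : Hom A B) (n : Hom C D) (f f' : Hom B C)
    (φ : f ⇒ f') :
  eqv ((m ◁ φ) ▷ n) (m ◁ (φ ▷ n)).
Proof. apply eqv_hcomp_assoc. Qed.

Lemma eqv_whisk10 (A B : K) (m : Hom A B) (f : Hom B B) (φ : f ⇒ id1 B) :
  eqv (whisk10 m φ) (m ◁ φ).
Proof. apply eqv_idto_l, eqv_refl. Qed.

Lemma eqv_whisk02 (A B C : K) (m : Hom A B) (g : Hom B C) (h : Hom C B)
    (φ : id1 B ⇒ g • h) :
  eqv (whisk02 m φ) (m ◁ φ).
Proof. apply eqv_idto_r, eqv_idto_l, eqv_refl. Qed.

Lemma eqv_whisk20 (A B C : K) (m : Hom A B) (g : Hom B C) (h : Hom C B)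
    (φ : g • h ⇒ id1 B) :
  eqv (whisk20 m φ) (m ◁ φ).
Proof. apply eqv_idto_r, eqv_idto_l, eqv_refl. Qed.

Lemma eqv_whisk12 (A B C D : K) (m : Hom A B) (f : Hom B D) (g : Hom B C)
    (h : Hom C D) (φ : f ⇒ g • h) :
  eqv (whisk12 m φ) (m ◁ φ).
Proof. apply eqv_idto_l, eqv_refl. Qed.

Lemma eqv_whisk22 (A B C C' D : K) (m : Hom A B) (f : Hom B C') (f' : Hom C' D)
    (g : Hom B C) (h : Hom C D) (φ : f • f' ⇒ g • h) :
  eqv (whisk22 m φ) (m ◁ φ).
Proof. apply eqv_idto_r, eqv_idto_l, eqv_refl. Qed.

Lemma eqv_whisk31 (A B C C' D : K) (m : Hom A B) (f : Hom B C) (f' : Hom C C')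
    (f'' : Hom C' D) (g : Hom B D) (φ : f • f' • f'' ⇒ g) :
  eqv (whisk31 m φ) (m ◁ φ).
Proof.
  eapply eqv_id_r; [apply eqv_wr_id|]. apply eqv_idto_r, eqv_refl.
Qed.

Lemma eqv_whisk23 (A B C C' D D' : K) (m : Hom A B) (f : Hom B C')
    (f' : Hom C' D) (g : Hom B C) (h : Hom C D') (k : Hom D' D)
    (φ : f • f' ⇒ g • h • k) :
  eqv (whisk23 m φ) (m ◁ φ).
Proof.
  apply eqv_idto_r. unfold whisk23. rewrite comp_assoc.
  eapply eqv_id_l; [apply eqv_wr_id|]. apply eqv_idto_l, eqv_refl.
Qed.

Lemma eqv_natural (A B C : K) (m n : Hom A B) (f g : Hom B C)
    (u : m ⇒ n) (φ : f ⇒ g) (x y z t : Hom A C)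
    (a : y ⇒ t) (b : x ⇒ y) (b' : z ⇒ t) (a' : x ⇒ z) :
  eqv a (n ◁ φ) -> eqv b (u ▷ f) -> eqv b' (u ▷ g) -> eqv a' (m ◁ φ) ->
  a ∘ b = b' ∘ a'.
Proof.
  intros Ha Hb Hb' Ha'. apply eqv_eq.
  eapply eqv_trans; [apply eqv_comp; eassumption|].
  rewrite interchange. apply eqv_sym, eqv_comp; assumption.
Qed.

Lemma whisk10_natural (A B : K) (m n : Hom A B) (u : m ⇒ n)
    (f : Hom B B) (φ : f ⇒ id1 B) :
  whisk10 n φ ∘ (u ▷ f) = u ∘ whisk10 m φ.
Proof.
  eapply eqv_natural; [apply eqv_whisk10 | apply eqv_refl | | apply eqv_whisk10].
  apply eqv_sym, eqv_hcomp_idr.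
Qed.

Lemma whisk02_natural (A B C : K) (m n : Hom A B) (u : m ⇒ n)
    (g : Hom B C) (h : Hom C B) (φ : id1 B ⇒ g • h) :
  whisk02 n φ ∘ u = (u ▷ g ▷ h) ∘ whisk02 m φ.
Proof.
  eapply eqv_natural;
    [apply eqv_whisk02 | | apply eqv_wr_comp1 | apply eqv_whisk02].
  apply eqv_sym, eqv_hcomp_idr.
Qed.

Lemma whisk20_natural (A B C : K) (m n : Hom A B) (u : m ⇒ n)
    (g : Hom B C) (h : Hom C B) (φ : g • h ⇒ id1 B) :
  whisk20 n φ ∘ (u ▷ g ▷ h) = u ∘ whisk20 m φ.
Proof.
  eapply eqv_natural;
    [apply eqv_whisk20 | apply eqv_wr_comp1 | | apply eqv_whisk20].
  apply eqv_sym, eqv_hcomp_idr.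
Qed.

Lemma whisk12_natural (A B C D : K) (m n : Hom A B) (u : m ⇒ n)
    (f : Hom B D) (g : Hom B C) (h : Hom C D) (φ : f ⇒ g • h) :
  whisk12 n φ ∘ (u ▷ f) = (u ▷ g ▷ h) ∘ whisk12 m φ.
Proof.
  eapply eqv_natural;
    [apply eqv_whisk12 | apply eqv_refl | apply eqv_wr_comp1 | apply eqv_whisk12].
Qed.

Lemma whisk22_natural (A B C C' D : K) (m n : Hom A B) (u : m ⇒ n)
    (f : Hom B C') (f' : Hom C' D) (g : Hom B C) (h : Hom C D)
    (φ : f • f' ⇒ g • h) :
  whisk22 n φ ∘ (u ▷ f ▷ f') = (u ▷ g ▷ h) ∘ whisk22 m φ.
Proof.
  eapply eqv_natural;
    [apply eqv_whisk22 | apply eqv_wr_comp1 | apply eqv_wr_comp1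
    | apply eqv_whisk22].
Qed.

Lemma whisk23_natural (A B C C' D D' : K) (m n : Hom A B) (u : m ⇒ n)
    (f : Hom B C') (f' : Hom C' D) (g : Hom B C) (h : Hom C D') (k : Hom D' D)
    (φ : f • f' ⇒ g • h • k) :
  whisk23 n φ ∘ (u ▷ f ▷ f') = (u ▷ g ▷ h ▷ k) ∘ whisk23 m φ.
Proof.
  eapply eqv_natural;
    [apply eqv_whisk23 | apply eqv_wr_comp1 | | apply eqv_whisk23].
  eapply eqv_trans; [apply eqv_wr, eqv_wr_comp1 | apply eqv_wr_comp1].
Qed.

Lemma eqv_wl_nested (A B C D : K) (m : Hom A B) (n : Hom B C) (f f' : Hom C D)
    (φ : f ⇒ f') (x x' : Hom A D) (y y' : Hom B D) (a : x ⇒ x') (b : y ⇒ y') :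
  eqv a (m • n ◁ φ) -> eqv b (n ◁ φ) -> eqv a (m ◁ b).
Proof.
  intros Ha Hb. eapply eqv_trans; [exact Ha|].
  eapply eqv_trans; [apply eqv_wl_comp1|]. now apply eqv_wl, eqv_sym.
Qed.

Lemma eqv_wr_wl (A B C D : K) (m : Hom A B) (n : Hom C D) (f f' : Hom B C)
    (φ : f ⇒ f') (x x' : Hom A C) (a : x ⇒ x') :
  eqv a (m ◁ φ) -> eqv (a ▷ n) (m ◁ (φ ▷ n)).
Proof.
  intros Ha. eapply eqv_trans; [apply eqv_wr, Ha | apply eqv_wl_wr].
Qed.

Lemma eqv_wl_idto_l (A B C : K) (m : Hom A B) (f g h : Hom B C)
    (e : g = h) (φ : f ⇒ g) (x x' : Hom A C) (a : x ⇒ x') :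
  eqv a (m ◁ φ) -> eqv a (m ◁ (idto e ∘ φ)).
Proof.
  intros Ha. eapply eqv_trans; [exact Ha|].
  apply eqv_wl, eqv_sym, eqv_idto_l, eqv_refl.
Qed.

Lemma eqv_wl_idto_r (A B C : K) (m : Hom A B) (f g h : Hom B C)
    (e : f = g) (φ : g ⇒ h) (x x' : Hom A C) (a : x ⇒ x') :
  eqv a (m ◁ φ) -> eqv a (m ◁ (φ ∘ idto e)).
Proof.
  intros Ha. eapply eqv_trans; [exact Ha|].
  apply eqv_wl, eqv_sym, eqv_idto_r, eqv_refl.
Qed.

Lemma eqv_wl_comp (A B C : K) (m : Hom A B) (f g h : Hom B C)
    (ψ : g ⇒ h) (φ : f ⇒ g) (x y z : Hom A C) (b : y ⇒ z) (a : x ⇒ y) :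
  eqv b (m ◁ ψ) -> eqv a (m ◁ φ) -> eqv (b ∘ a) (m ◁ (ψ ∘ φ)).
Proof. intros Hb Ha. rewrite wl_comp. now apply eqv_comp. Qed.

Lemma wl_eq (A B C : K) (m : Hom A B) (f g : Hom B C) (ψ φ : f ⇒ g)
    (x y : Hom A C) (a b : x ⇒ y) :
  ψ = φ -> eqv a (m ◁ ψ) -> eqv b (m ◁ φ) -> a = b.
Proof.
  intros <- Ha Hb. apply eqv_eq. eapply eqv_trans; [exact Ha|].
  now apply eqv_sym.
Qed.

Lemma eqv_idm_wl (A B C : K) (m : Hom A B) (f : Hom B C) :
  eqv (idm (m • f)) (m ◁ idm f).
Proof. rewrite hcomp_id; apply eqv_refl. Qed.

End StrictEq.

Create HintDb strict discriminated.
#[global] Hint Resolve eqv_whisk10 eqv_whisk02 eqv_whisk20 eqv_whisk12 eqv_whisk22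
  eqv_whisk23 eqv_whisk31 eqv_idm_wl eqv_wl_comp eqv_wr_wl eqv_wl_idto_l
  eqv_wl_idto_r : strict.
#[global] Hint Extern 3 (eqv _ _) =>
  eapply eqv_wl_nested; [solve [auto with strict] | solve [auto with strict]]
  : strict.

Section Whiskered.

Context {K : TwoCategory}.

Lemma delta_coassoc_at (Ω A : K) (c : Comonad A) (m : Hom Ω A) :
  (whisk12 m (cmd_delta c) ▷ c) ∘ whisk12 m (cmd_delta c)
  = whisk12 (m • c) (cmd_delta c) ∘ whisk12 m (cmd_delta c).
Proof. eapply wl_eq; [apply (cmd_coassoc c)| |]; auto with strict. Qed.

Lemma counit_left_at (Ω A : K) (c : Comonad A) (m : Hom Ω A) :
  (whisk10 m (cmd_eps c) ▷ c) ∘ whisk12 m (cmd_delta c) = idm (m • c).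
Proof.
  eapply wl_eq; [apply (cmd_counit_left c)| |]; [|auto with strict].
  rewrite comp_assoc. unfold lun; auto 6 with strict.
Qed.

Lemma counit_right_at (Ω A : K) (c : Comonad A) (m : Hom Ω A) :
  whisk10 (m • c) (cmd_eps c) ∘ whisk12 m (cmd_delta c) = idm (m • c).
Proof. eapply wl_eq; [apply (cmd_counit_right c)| |]; auto with strict. Qed.

Context {A B : K} {d : Comonad B} {c : Comonad A} (pq : ComonadMorphAdj d c).

Let p := cma_p pq.
Let q := cma_q pq.

Lemma zigzag_q_at (Ω : K) (m : Hom Ω B) :
  whisk20 (m • q) (cma_mu pq) ∘ (whisk02 m (cma_eta pq) ▷ q) = idm (m • q).
Proof.
  eapply wl_eq; [apply (cma_zigzag_q pq)| |]; [|auto with strict].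
  unfold lun'; auto 6 with strict.
Qed.

Lemma zigzag_p_at (Ω : K) (m : Hom Ω A) :
  (whisk20 m (cma_mu pq) ▷ p) ∘ whisk02 (m • p) (cma_eta pq) = idm (m • p).
Proof.
  eapply wl_eq; [apply (cma_zigzag_p pq)| |]; [|auto with strict].
  rewrite comp_assoc. unfold lun; auto 6 with strict.
Qed.

Lemma alpha_delta_at (Ω : K) (m : Hom Ω B) :
  whisk12 (m • q) (cmd_delta c) ∘ whisk22 m (cma_alpha pq)
  = (whisk22 m (cma_alpha pq) ▷ c) ∘ whisk22 (m • d) (cma_alpha pq)
    ∘ (whisk12 m (cmd_delta d) ▷ q).
Proof. eapply wl_eq; [apply (cma_alpha_delta pq)| |]; auto 6 with strict. Qed.

Lemma alpha_eps_at (Ω : K) (m : Hom Ω B) :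
  whisk10 (m • q) (cmd_eps c) ∘ whisk22 m (cma_alpha pq)
  = whisk10 m (cmd_eps d) ▷ q.
Proof.
  eapply wl_eq; [apply (cma_alpha_eps pq)| |]; unfold lun; auto 6 with strict.
Qed.

Lemma can_at (Ω : K) (m : Hom Ω A) :
  whisk31 m (can_cell pq)
  = (whisk20 m (cma_mu pq) ▷ c) ∘ whisk22 (m • p) (cma_alpha pq).
Proof.
  eapply wl_eq; [reflexivity| |]; [auto with strict|].
  unfold can_cell. rewrite comp_assoc. unfold lun; auto 6 with strict.
Qed.

Lemma beta_at (Ω : K) (m : Hom Ω A) :
  whisk22 m (beta_cell pq)
  = (whisk31 m (can_cell pq) ▷ p) ∘ whisk02 (m • p • d) (cma_eta pq).
Proof.
  eapply wl_eq; [reflexivity| |]; [auto with strict|].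
  unfold beta_cell. apply eqv_wl_comp; [auto with strict|].
  eapply eqv_wl_nested; [|apply eqv_whisk02].
  eapply eqv_trans; [apply eqv_whisk02|].
  apply eqv_hcomp; [|apply eqv_refl].
  exists (comp1_assoc m p d), (comp1_assoc m p d). now rewrite comp_idl, comp_idr.
Qed.

Lemma lambda_at (Ω : K) (m : Hom Ω A) :
  whisk23 m (lambda_cell pq)
  = (whisk22 m (beta_cell pq) ▷ d) ∘ whisk12 (m • p) (cmd_delta d).
Proof.
  eapply wl_eq; [reflexivity| |]; [auto with strict|].
  unfold lambda_cell. auto 6 with strict.
Qed.

End Whiskered.

Section Rcom.

Context {K : TwoCategory} (Ω : K) {A : K} (c : Comonad A).

Lemma comodule_hom_eq (m n : Comodule Ω c) (φ ψ : ComoduleHom m n) :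
  proj1_sig φ = proj1_sig ψ -> φ = ψ.
Proof.
  destruct φ as [φ Hφ], ψ as [ψ Hψ]; simpl; intros ->.
  f_equal; apply proof_irrelevance.
Qed.

Lemma comodule_id_colinear (m : Comodule Ω c) :
  cmod_coact m ∘ idm (cmod_cell m) = (idm (cmod_cell m) ▷ c) ∘ cmod_coact m.
Proof. now rewrite hcomp_id, comp_idl, comp_idr. Qed.

Lemma comodule_comp_colinear (m n k : Comodule Ω c)
    (ψ : ComoduleHom n k) (φ : ComoduleHom m n) :
  cmod_coact k ∘ (proj1_sig ψ ∘ proj1_sig φ)
  = ((proj1_sig ψ ∘ proj1_sig φ) ▷ c) ∘ cmod_coact m.
Proof.
  rewrite wr_comp, comp_assoc, <- (proj2_sig φ), <- !comp_assoc.
  now rewrite (proj2_sig ψ).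
Qed.

Definition Rcom : Category.
Proof.
  refine {|
    ob := Comodule Ω c;
    hom := @ComoduleHom K Ω A c;
    idm := fun m => exist _ (idm (cmod_cell m)) (comodule_id_colinear m);
    comp := fun m n k ψ φ =>
      exist _ (proj1_sig ψ ∘ proj1_sig φ) (comodule_comp_colinear ψ φ) |};
  abstract (intros; apply comodule_hom_eq; simpl;
            auto using comp_idl, comp_idr, comp_assoc).
Defined.

Definition forget : Functor Rcom (Hom Ω A).
Proof.
  refine {| fobj := fun m : Rcom => cmod_cell m;
            fmap := fun (m n : Rcom) (φ : m ⇒ n) => proj1_sig φ |};
  abstract reflexivity.
Defined.

End Rcom.

Section PostcompFunctor.

Context {K : TwoCategory} (Ω : K) {A B : K} (g : Hom A B).

Definition postcomp : Functor (Hom Ω A) (Hom Ω B).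
Proof.
  refine {| fobj := fun m : Hom Ω A => m • g;
            fmap := fun (m n : Hom Ω A) (φ : m ⇒ n) => φ ▷ g |};
  abstract (intros; auto using hcomp_id, wr_comp).
Defined.

End PostcompFunctor.

Section Cofree.

Context {K : TwoCategory} (Ω : K) {B : K} (d : Comonad B).

Definition cofree_comodule (k : Hom Ω B) : Rcom Ω d :=
  {| cmod_cell := k • d;
     cmod_coact := whisk12 k (cmd_delta d);
     cmod_coassoc := delta_coassoc_at d k;
     cmod_counit := counit_right_at d k |}.

Definition cofree_hom (k l : Hom Ω B) (u : k ⇒ l) :
    cofree_comodule k ⇒ cofree_comodule l :=
  exist _ (u ▷ d) (whisk12_natural u (cmd_delta d)).

Definition cofree : Functor (Hom Ω B) (Rcom Ω d).
Proof.
  refine {| fobj := cofree_comodule; fmap := cofree_hom |};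
  abstract (intros; apply comodule_hom_eq; simpl; auto using hcomp_id, wr_comp).
Defined.

End Cofree.

Section PushPull.

Context {K : TwoCategory} (Ω : K) {A B : K} {d : Comonad B} {c : Comonad A}.
Context (pq : ComonadMorphAdj d c).

Let p := cma_p pq.
Let q := cma_q pq.

Definition pushout_coact (x : Comodule Ω d) : x • q ⇒ x • q • c :=
  whisk22 x (cma_alpha pq) ∘ (cmod_coact x ▷ q).

Lemma pushout_coassoc (x : Comodule Ω d) :
  (pushout_coact x ▷ c) ∘ pushout_coact x
  = whisk12 (x • q) (cmd_delta c) ∘ pushout_coact x.
Proof.
  unfold pushout_coact. rewrite wr_comp, !comp_assoc.
  rewrite <- (comp_assoc (cmod_coact x ▷ q ▷ c)), <- whisk22_natural.
  rewrite <- (comp_assoc (whisk12 _ _)), (alpha_delta_at pq), !comp_assoc.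
  now rewrite <- !wr_comp, cmod_coassoc.
Qed.

Lemma pushout_counit (x : Comodule Ω d) :
  whisk10 (x • q) (cmd_eps c) ∘ pushout_coact x = idm (x • q).
Proof.
  unfold pushout_coact. rewrite <- comp_assoc, (alpha_eps_at pq).
  now rewrite <- wr_comp, cmod_counit, hcomp_id.
Qed.

Definition pushout_ob (x : Rcom Ω d) : Rcom Ω c :=
  {| cmod_cell := cmod_cell x • q;
     cmod_coact := pushout_coact x;
     cmod_coassoc := pushout_coassoc x;
     cmod_counit := pushout_counit x |}.

Lemma pushout_colinear (x y : Rcom Ω d) (φ : x ⇒ y) :
  pushout_coact y ∘ (proj1_sig φ ▷ q)
  = (proj1_sig φ ▷ q ▷ c) ∘ pushout_coact x.
Proof.
  unfold pushout_coact. rewrite comp_assoc, <- wr_comp, (proj2_sig φ), wr_comp.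
  now rewrite <- !comp_assoc, whisk22_natural.
Qed.

Definition pushout : Functor (Rcom Ω d) (Rcom Ω c).
Proof.
  refine {| fobj := pushout_ob;
            fmap := fun x y (φ : x ⇒ y) =>
              exist _ (proj1_sig φ ▷ q) (pushout_colinear φ)
                : pushout_ob x ⇒ pushout_ob y |};
  abstract (intros; apply comodule_hom_eq; simpl; auto using hcomp_id, wr_comp).
Defined.

Definition tensor_q : Functor (Rcom Ω d) (Hom Ω A) := postcomp Ω q ∘F forget Ω d.

Definition tensor_pd : Functor (Hom Ω A) (Rcom Ω d) := cofree Ω d ∘F postcomp Ω p.

Definition unit_cell (m : Comodule Ω d) : m ⇒ m • q • p • d :=
  (whisk02 m (cma_eta pq) ▷ d) ∘ cmod_coact m.

Definition counit_cell (n : Hom Ω A) : n • p • d • q ⇒ n :=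
  whisk20 n (cma_mu pq) ∘ (whisk10 (n • p) (cmd_eps d) ▷ q).

Lemma unit_cell_colinear (m : Rcom Ω d) :
  whisk12 (cmod_cell m • q • p) (cmd_delta d) ∘ unit_cell m
  = (unit_cell m ▷ d) ∘ cmod_coact m.
Proof.
  unfold unit_cell. rewrite <- comp_assoc, whisk12_natural, wr_comp, !comp_assoc.
  now rewrite cmod_coassoc.
Qed.

Lemma unit_cell_natural (m n : Rcom Ω d) (φ : m ⇒ n) :
  unit_cell n ∘ proj1_sig φ = (proj1_sig φ ▷ q ▷ p ▷ d) ∘ unit_cell m.
Proof.
  unfold unit_cell. rewrite comp_assoc, (proj2_sig φ), <- !comp_assoc.
  now rewrite <- !wr_comp, whisk02_natural.
Qed.

Lemma counit_cell_natural (m n : Hom Ω A) (u : m ⇒ n) :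
  counit_cell n ∘ (u ▷ p ▷ d ▷ q) = u ∘ counit_cell m.
Proof.
  unfold counit_cell. rewrite comp_assoc, <- wr_comp, whisk10_natural, wr_comp.
  now rewrite <- !comp_assoc, whisk20_natural.
Qed.

Definition tensor_unit : NatTrans (functor_id (Rcom Ω d)) (tensor_pd ∘F tensor_q).
Proof.
  refine {| nt_app := fun m : Rcom Ω d =>
              exist _ (unit_cell m) (unit_cell_colinear m)
                : functor_id _ m ⇒ (tensor_pd ∘F tensor_q) m |}.
  abstract (intros; apply comodule_hom_eq; apply unit_cell_natural).
Defined.

Definition tensor_counit : NatTrans (tensor_q ∘F tensor_pd) (functor_id (Hom Ω A)) :=
  {| nt_app := fun n : Hom Ω A =>
       counit_cell n : (tensor_q ∘F tensor_pd) n ⇒ functor_id _ n;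
     nt_natural := counit_cell_natural |}.

Lemma tensor_triangle_left (m : Rcom Ω d) :
  counit_cell (cmod_cell m • q) ∘ (unit_cell m ▷ q) = idm (cmod_cell m • q).
Proof.
  unfold counit_cell, unit_cell. rewrite comp_assoc, <- wr_comp.
  rewrite <- comp_assoc, whisk10_natural, comp_assoc, cmod_counit, comp_idr.
  apply (zigzag_q_at pq).
Qed.

Lemma tensor_triangle_right (n : Hom Ω A) :
  (counit_cell n ▷ p ▷ d) ∘ unit_cell (cofree_comodule d (n • p))
  = idm (n • p • d).
Proof.
  unfold counit_cell, unit_cell; simpl. rewrite <- comp_assoc, <- wr_comp.
  rewrite (wr_comp p), comp_assoc, <- whisk02_natural, <- comp_assoc.
  rewrite (zigzag_p_at pq), comp_idl. apply counit_left_at.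
Qed.

Definition tensor_adj : Adjunction tensor_q tensor_pd.
Proof.
  refine {| adj_unit := tensor_unit; adj_counit := tensor_counit |}.
  - exact tensor_triangle_left.
  - abstract (intros; apply comodule_hom_eq; apply tensor_triangle_right).
Defined.

Lemma lambda_colinear (n : Hom Ω A) :
  whisk12 (n • c • p) (cmd_delta d) ∘ whisk23 n (lambda_cell pq)
  = (whisk23 n (lambda_cell pq) ▷ d) ∘ whisk12 (n • p) (cmd_delta d).
Proof.
  rewrite lambda_at, <- comp_assoc, whisk12_natural, wr_comp, !comp_assoc.
  now rewrite delta_coassoc_at.
Qed.

Definition pair_coact (n : Rcom Ω c) :
    tensor_pd (cmod_cell n) ⇒ tensor_pd (cmod_cell n • c) :=
  fmap tensor_pd (cmod_coact n).

Definition pair_lambda (n : Rcom Ω c) :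
    tensor_pd (cmod_cell n) ⇒ tensor_pd (cmod_cell n • c) :=
  exist _ (whisk23 (cmod_cell n) (lambda_cell pq)) (lambda_colinear (cmod_cell n)).

(** A choice of equalizers; the functor [pullback] below depends on it, up to
    isomorphism only. *)
Definition EqualizerCondition : Type :=
  forall n : Rcom Ω c, Equalizer (pair_coact n) (pair_lambda n).

Section Pullback.

Context (E : EqualizerCondition).

Lemma pullback_equalizes (n n' : Rcom Ω c) (φ : n ⇒ n') :
  let h := fmap tensor_pd (fmap (forget Ω c) φ) ∘ equ_arr (E n) in
  pair_coact n' ∘ h = pair_lambda n' ∘ h.
Proof.
  intros h; unfold h; clear h. rewrite <- !comp_assoc.
  assert (H1 : pair_coact n' ∘ fmap tensor_pd (fmap (forget Ω c) φ)
               = fmap tensor_pd (proj1_sig φ ▷ c) ∘ pair_coact n).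
  { unfold pair_coact. rewrite <- !fmap_comp. f_equal. exact (proj2_sig φ). }
  assert (H2 : pair_lambda n' ∘ fmap tensor_pd (fmap (forget Ω c) φ)
               = fmap tensor_pd (proj1_sig φ ▷ c) ∘ pair_lambda n).
  { apply comodule_hom_eq; apply whisk23_natural. }
  rewrite H1, H2, !comp_assoc. f_equal. apply (equ_is_equalizer (E n)).
Qed.

Definition pullback : Functor (Rcom Ω c) (Rcom Ω d).
Proof.
  refine {| fobj := fun n => equ_ob (E n);
            fmap := fun n n' (φ : n ⇒ n') =>
              equ_lift (E n') (pullback_equalizes φ) |}.
  - abstract (intros n; apply equ_arr_mono;
      rewrite equ_lift_arr, !fmap_id, comp_idl, comp_idr; reflexivity).
  - abstract (intros n n' n'' ψ φ; apply equ_arr_mono;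
      rewrite equ_lift_arr, <- comp_assoc, equ_lift_arr, comp_assoc,
        equ_lift_arr, !fmap_comp, comp_assoc; reflexivity).
Defined.

End Pullback.

End PushPull.

Section CanBar.

Context {K : TwoCategory} {A B : K} {d : Comonad B} {c : Comonad A}.
Context (pq : ComonadMorphAdj d c).

Let p := cma_p pq.
Let q := cma_q pq.

(** [d] as a comodule over itself: the coactions below are then [Δ_d] and
    [ρ^{d • q}], and [unit_cell pq d_comodule] is [(d • η • d) ∘ Δ_d]. *)
Definition d_comodule : Rcom B d :=
  {| cmod_cell := d : Hom B B;
     cmod_coact := cmd_delta d;
     cmod_coassoc := cmd_coassoc d;
     cmod_counit := cmd_counit_right d |}.

Definition rho_dq : d • q ⇒ d • q • c := cmod_coact (pushout B pq d_comodule).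

Lemma beta_eta_at (m : Hom B B) :
  whisk22 (m • q) (beta_cell pq) ∘ (whisk02 m (cma_eta pq) ▷ d)
  = (whisk22 m (cma_alpha pq) ▷ p) ∘ whisk02 (m • d) (cma_eta pq).
Proof.
  rewrite beta_at, comp_assoc, whisk02_natural, <- comp_assoc, <- wr_comp.
  do 2 f_equal. rewrite can_at, comp_assoc, whisk22_natural, <- comp_assoc.
  now rewrite <- wr_comp, (zigzag_q_at pq), hcomp_id, comp_idl.
Qed.

Lemma can_bar_equalizes :
  (rho_dq ▷ p ▷ d) ∘ unit_cell pq d_comodule
  = whisk23 (d • q) (lambda_cell pq) ∘ unit_cell pq d_comodule.
Proof.
  unfold unit_cell. rewrite lambda_at, comp_assoc.
  rewrite <- (comp_assoc (whisk12 _ _)), whisk12_natural, <- !comp_assoc.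
  rewrite <- !wr_comp, beta_eta_at, (comp_assoc _ (whisk12 _ _)).
  simpl. rewrite <- cmd_coassoc. unfold rho_dq; simpl; unfold pushout_coact; simpl.
  rewrite <- comp_assoc, <- wr_comp. do 2 f_equal.
  rewrite wr_comp, !comp_assoc. f_equal. symmetry; apply whisk02_natural.
Qed.

(** Existence of the equalizer in [Hom B B] is part of the condition. *)
Definition can_bar_is_iso : Prop :=
  exists E : Equalizer (rho_dq ▷ p ▷ d) (whisk23 (d • q) (lambda_cell pq)),
    is_iso (equ_lift E can_bar_equalizes).

End CanBar.

(* Main.v *)
Require Import Defs.

Set Implicit Arguments.
Unset Strict Implicit.
Unset Printing Implicit Defensive.

(** Write [F ⊣ G] for the adjunction [tensor_q ⊣ tensor_pd], with unit [θ] and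
    counit [κ].  The 2-cells [n • can : F (G n) ⇒ n • c] satisfy
    [λ = G (n • can) ∘ θ_(G n)] and [(n • can) ∘ F g = (ĝ • c) ∘ ρ^(x • q)], where
    [g : x ⇒ G n] is colinear and [ĝ] is its adjunct; hence [g] equalizes the pair
    defining [n •^c (p • d)] exactly when [ĝ] is [c]-colinear, which yields the
    adjunction between the pushout and the pullback functors.

    If [can] is invertible, the image under [F] of this pair is split by
    [can⁻¹ ∘ ρ^n : n ⇒ F (G n)].  By [H]-separability the splitting lifts along
    [H], so [Q'] preserves the equalizer [H (n •^c (p • d))], and the counit is
    mapped by [H'] to the comparison of two equalizers of the same pair.
    For [n = x • q] the pair is [G (F θ_x)], [θ_(G (F x))] followed by an
    isomorphism, so that [H]-separability also makes [H θ_x] a split equalizer of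
    its image under [H], and [H] maps the unit to a comparison of equalizers. *)

Local Open Scope cat_scope.

(** * Isomorphisms in a category *)

Section Isomorphisms.

Context {C : Category}.

Lemma is_iso_comp (x y z : C) (g : y ⇒ z) (f : x ⇒ y) :
  is_iso g -> is_iso f -> is_iso (g ∘ f).
Proof.
  intros [g' [Hg1 Hg2]] [f' [Hf1 Hf2]]. exists (f' ∘ g'). split.
  - rewrite comp_assoc, <- (comp_assoc g'), Hg1, comp_idl; exact Hf1.
  - rewrite comp_assoc, <- (comp_assoc f), Hf2, comp_idl; exact Hg2.
Qed.

Lemma is_iso_idto (x y : C) (e : x = y) : is_iso (idto e).
Proof. destruct e; exists (idm x); simpl; now rewrite comp_idl. Qed.

Lemma is_iso_fmap (D : Category) (F : Functor C D) (x y : C) (f : x ⇒ y) :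
  is_iso f -> is_iso (fmap F f).
Proof.
  intros [g [H1 H2]]. exists (fmap F g).
  now rewrite <- !fmap_comp, H1, H2, !fmap_id.
Qed.

Lemma is_iso_mono (x y z : C) (f : y ⇒ z) (u v : x ⇒ y) :
  is_iso f -> f ∘ u = f ∘ v -> u = v.
Proof.
  intros [g [H1 _]] Huv.
  now rewrite <- (comp_idl u), <- (comp_idl v), <- H1, !comp_assoc, Huv.
Qed.

End Isomorphisms.

(** * Split equalizers and comparison of equalizers *)

Definition split_equalizer {C : Category} {x y z : C} (f g : y ⇒ z) (i : x ⇒ y) : Prop :=
  f ∘ i = g ∘ i /\
  exists (s : y ⇒ x) (t : z ⇒ y), s ∘ i = idm x /\ t ∘ g = idm y /\ t ∘ f = i ∘ s.

Section SplitEqualizers.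

Context {C : Category}.

Lemma split_equalizer_is_equalizer (x y z : C) (f g : y ⇒ z) (i : x ⇒ y) :
  split_equalizer f g i -> is_equalizer f g i.
Proof.
  intros [Hi [s [t [Hs [Hg Hf]]]]]. split; [exact Hi|].
  intros w h Hh. exists (s ∘ h). split.
  - now rewrite <- comp_assoc, <- Hf, comp_assoc, Hh, <- comp_assoc, Hg, comp_idl.
  - intros u <-. now rewrite <- comp_assoc, Hs, comp_idl.
Qed.

Lemma split_equalizer_fmap (D : Category) (F : Functor C D) (x y z : C)
    (f g : y ⇒ z) (i : x ⇒ y) :
  split_equalizer f g i -> split_equalizer (fmap F f) (fmap F g) (fmap F i).
Proof.
  intros [Hi [s [t [Hs [Hg Hf]]]]]. split; [now rewrite <- !fmap_comp, Hi|].
  exists (fmap F s), (fmap F t).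
  now rewrite <- !fmap_comp, Hs, Hg, Hf, !fmap_id.
Qed.

(** The last hypothesis makes [t ∘ f] factor through [i], and the factor is the missing [s].
    Uniqueness of factorizations gives [s ∘ i = idm x], because [t ∘ f ∘ i = t ∘ g ∘ i = i]. *)
Lemma equalizer_of_contractible_pair (x y z : C) (f g : y ⇒ z) (i : x ⇒ y)
    (t : z ⇒ y) :
  is_equalizer f g i -> t ∘ g = idm y -> f ∘ (t ∘ f) = g ∘ (t ∘ f) ->
  split_equalizer f g i.
Proof.
  intros [Hi Hu] Hg Hf. split; [exact Hi|].
  destruct (Hu _ _ Hf) as [s [Hs _]]. exists s, t. repeat split; auto.
  destruct (Hu _ _ Hi) as [u [_ Hu']].
  rewrite <- (Hu' (idm x)) by apply comp_idr. symmetry; apply Hu'.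
  now rewrite <- comp_assoc, Hs, comp_assoc, Hi, <- comp_assoc, Hg, comp_idl.
Qed.

Lemma is_equalizer_iso_comp (x y z z' : C) (f g : y ⇒ z) (i : x ⇒ y) (w : z ⇒ z') :
  is_iso w -> is_equalizer f g i -> is_equalizer (w ∘ f) (w ∘ g) i.
Proof.
  intros Hw [Hi Hu]. split; [now rewrite !comp_assoc, Hi|].
  intros v h Hh. apply Hu. rewrite !comp_assoc in Hh.
  exact (is_iso_mono Hw Hh).
Qed.

Lemma equalizer_comparison_is_iso (x x' y z : C) (f g : y ⇒ z)
    (i : x ⇒ y) (i' : x' ⇒ y) (u : x ⇒ x') :
  is_equalizer f g i -> is_equalizer f g i' -> i' ∘ u = i -> is_iso u.
Proof.
  intros [Hi Hui] [Hi' Hui'] Hu.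
  destruct (Hui _ _ Hi') as [v [Hv _]]. exists v. split.
  - destruct (Hui _ _ Hi) as [k [_ Hk]].
    rewrite <- (Hk (idm x)) by apply comp_idr. symmetry; apply Hk.
    now rewrite <- comp_assoc, Hv.
  - destruct (Hui' _ _ Hi') as [k [_ Hk]].
    rewrite <- (Hk (idm x')) by apply comp_idr. symmetry; apply Hk.
    now rewrite <- comp_assoc, Hu.
Qed.

(** Transport along Leibniz equality: the assumed equality of composite functors is not
    definitional. *)
Lemma is_equalizer_functor_eq (D : Category) (F G : Functor C D) (x y z : C)
    (f g : y ⇒ z) (i : x ⇒ y) :
  F = G -> is_equalizer (fmap F f) (fmap F g) (fmap F i) ->
  is_equalizer (fmap G f) (fmap G g) (fmap G i).
Proof. now intros <-. Qed.

End SplitEqualizers.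

(** [adj_unit] and [adj_counit] with [functor_id] and [∘F] unfolded in their types,
    as the syntactic matching of [rewrite] requires. *)
Definition unit_at {C D : Category} {F : Functor C D} {G : Functor D C}
    (adj : Adjunction F G) (x : C) : x ⇒ G (F x) := adj_unit adj x.

Definition counit_at {C D : Category} {F : Functor C D} {G : Functor D C}
    (adj : Adjunction F G) (y : D) : F (G y) ⇒ y := adj_counit adj y.

(** * Adjunctions and [H]-separability *)

Section Adjunctions.

Context {C D : Category} {F : Functor C D} {G : Functor D C} (adj : Adjunction F G).

Lemma unit_at_natural (x y : C) (f : x ⇒ y) :
  unit_at adj y ∘ f = fmap G (fmap F f) ∘ unit_at adj x.
Proof. exact (nt_natural (adj_unit adj) f). Qed.

Lemma counit_at_natural (x y : D) (f : x ⇒ y) :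
  counit_at adj y ∘ fmap F (fmap G f) = f ∘ counit_at adj x.
Proof. exact (nt_natural (adj_counit adj) f). Qed.

Lemma triangle_left_at (x : C) :
  counit_at adj (F x) ∘ fmap F (unit_at adj x) = idm (F x).
Proof. exact (adj_triangle_left adj x). Qed.

Lemma triangle_right_at (y : D) :
  fmap G (counit_at adj y) ∘ unit_at adj (G y) = idm (G y).
Proof. exact (adj_triangle_right adj y). Qed.

Lemma right_adjoint_fully_faithful :
  (forall y, is_iso (counit_at adj y)) -> fully_faithful G.
Proof.
  intros Hiso x y g. destruct (Hiso x) as [k [Hk Hk']].
  exists (counit_at adj y ∘ fmap F g ∘ k). split.
  (* [fmap G k] is inverse to [fmap G (counit_at adj x)], of which the unit is a section by the
     triangle identity. *)
  - assert (HG : fmap G k = unit_at adj (G x)).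
    { rewrite <- (comp_idr (fmap G k)), <- triangle_right_at, <- comp_assoc.
      rewrite <- fmap_comp, Hk, fmap_id. apply comp_idl. }
    rewrite !fmap_comp, HG, comp_assoc, <- unit_at_natural, <- comp_assoc.
    now rewrite triangle_right_at, comp_idl.
  - intros f <-. now rewrite counit_at_natural, comp_assoc, Hk', comp_idr.
Qed.

Lemma left_adjoint_fully_faithful :
  (forall x, is_iso (unit_at adj x)) -> fully_faithful F.
Proof.
  intros Hiso x y g. destruct (Hiso y) as [k [Hk Hk']].
  exists (k ∘ (fmap G g ∘ unit_at adj x)). split.
  - assert (HF : fmap F k = counit_at adj (F y)).
    { rewrite <- (comp_idl (fmap F k)), <- triangle_left_at, comp_assoc.
      rewrite <- fmap_comp, Hk', fmap_id. apply comp_idr. }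
    rewrite !fmap_comp, HF, <- comp_assoc, counit_at_natural, comp_assoc.
    now rewrite triangle_left_at, comp_idr.
  - intros f <-. now rewrite <- unit_at_natural, <- comp_assoc, Hk, comp_idl.
Qed.

Context {X : Category} {H : Functor C X}.

Lemma h_separable_retraction :
  h_separable adj H ->
  exists xi : forall x, H (G (F x)) ⇒ H x,
    (forall x, xi x ∘ fmap H (unit_at adj x) = idm (H x)) /\
    forall x y (f : x ⇒ y),
      xi y ∘ fmap H (fmap G (fmap F f)) = fmap H f ∘ xi x.
Proof. intros [xi Hxi]. exists xi. split; [exact Hxi | exact (nt_natural xi)]. Qed.

(** The splitting lives in [D], and [i] need not be [fmap F e]. The adjunct of [t], followed by
    [xi], contracts the pair under [H]; the equalizer [fmap H e] supplies the rest of the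
    splitting. *)
Lemma h_separable_split_equalizer (x y z : C) (w : D) (f g : y ⇒ z) (e : x ⇒ y)
    (i : w ⇒ F y) :
  h_separable adj H -> split_equalizer (fmap F f) (fmap F g) i ->
  is_equalizer (fmap H f) (fmap H g) (fmap H e) ->
  split_equalizer (fmap H f) (fmap H g) (fmap H e).
Proof.
  intros Hsep [Hi [s [t [Hs [Hg Hf]]]]] He.
  destruct (h_separable_retraction Hsep) as [xi [Hxi Hnat]].
  assert (Hmate : forall h : y ⇒ z,
             xi y ∘ fmap H (fmap G t ∘ unit_at adj z) ∘ fmap H h
             = xi y ∘ fmap H (fmap G (t ∘ fmap F h)) ∘ fmap H (unit_at adj y)).
  { intros h. rewrite !comp_assoc, <- !fmap_comp, comp_assoc, unit_at_natural.
    now rewrite <- comp_assoc, <- fmap_comp. }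
  apply equalizer_of_contractible_pair
    with (t := xi y ∘ fmap H (fmap G t ∘ unit_at adj z)); [exact He| |].
  - rewrite Hmate, Hg, !fmap_id, comp_idr; apply Hxi.
  (* By naturality of [xi], the two sides differ only in [fmap F f ∘ i] against [fmap F g ∘ i]. *)
  - rewrite Hmate, Hf, <- !comp_assoc, <- !Hnat, !(comp_assoc (xi z)), <- !fmap_comp.
    now rewrite <- !comp_assoc, Hi.
Qed.

(** The retractions [xi x] and [xi (G (F x))] split the fork; the mixed relation is naturality of
    [xi] at the unit. *)
Lemma h_separable_unit_split_equalizer (x : C) :
  h_separable adj H ->
  split_equalizer (fmap H (fmap G (fmap F (unit_at adj x))))
                  (fmap H (unit_at adj (G (F x)))) (fmap H (unit_at adj x)).
Proof.
  intros Hsep. destruct (h_separable_retraction Hsep) as [xi [Hxi Hnat]]. split.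
  - now rewrite <- !fmap_comp, unit_at_natural.
  - exists (xi x), (xi (G (F x))). repeat split; [apply Hxi | apply Hxi |].
    apply Hnat.
Qed.

End Adjunctions.

(** * Invertibility of whiskered 2-cells and of comodule morphisms *)

Lemma whisk31_is_iso (K : TwoCategory) (Ω A B C D : K) (m : Hom Ω A) (f : Hom A B)
    (f' : Hom B C) (f'' : Hom C D) (g : Hom A D) (φ : f • f' • f'' ⇒ g) :
  is_iso φ -> is_iso (whisk31 m φ).
Proof.
  intros [ψ [H1 H2]]. apply is_iso_comp; [apply is_iso_comp|].
  - exists (m ◁ ψ). now rewrite <- !wl_comp, H1, H2, !hcomp_id.
  - apply is_iso_idto.
  - apply (is_iso_fmap (postcomp Ω f'')), is_iso_idto.
Qed.

(** Composing the colinearity square of [φ] with the inverse 2-cell on both sides gives that of the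
    inverse. *)
Lemma forget_reflects_isos (K : TwoCategory) (Ω A : K) (c : Comonad A) :
  reflects_isos (forget Ω c).
Proof.
  intros m n φ [ψ [H1 H2]]. simpl in *.
  assert (Hψ : cmod_coact m ∘ ψ = (ψ ▷ c) ∘ cmod_coact n).
  { rewrite <- (comp_idl (cmod_coact m)), <- hcomp_id, <- H1, wr_comp, !comp_assoc.
    rewrite <- (comp_assoc (proj1_sig φ ▷ c)), <- (proj2_sig φ), comp_assoc, H2.
    now rewrite comp_idr. }
  exists (exist _ ψ Hψ); split; now apply comodule_hom_eq.
Qed.

(** * The 2-cells [n • can] and the pair defining the pullback *)

Section PushPullAdjunction.

Context {K : TwoCategory} {A B : K} {d : Comonad B} {c : Comonad A}.
Context (pq : ComonadMorphAdj d c).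

Let q := cma_q pq.

Context {Ω : K}.

Let F := tensor_q Ω pq.
Let G := tensor_pd Ω pq.
Let θ := unit_at (tensor_adj Ω pq).
Let κ := counit_at (tensor_adj Ω pq).

Definition can_at_cell (n : Hom Ω A) : F (G n) ⇒ n • c := whisk31 n (can_cell pq).

(** In the coaction of [G n] the comultiplication of [d] cancels against the counit [ε_d] contained
    in [κ n]. The compatibilities of [n • can] with 2-cells, [ε_c] and [Δ_c] then follow from
    naturality and the comodule axioms of the pushout. *)
Lemma can_at_counit (n : Hom Ω A) :
  can_at_cell n = (κ n ▷ c) ∘ cmod_coact (pushout Ω pq (G n)).
Proof.
  unfold can_at_cell. rewrite can_at. unfold κ, counit_at. simpl.
  unfold counit_cell, pushout_coact.
  rewrite wr_comp, !comp_assoc. f_equal. simpl.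
  rewrite <- (comp_assoc (whisk10 _ _ ▷ _ ▷ _)), <- whisk22_natural, comp_assoc.
  rewrite <- wr_comp, counit_left_at, hcomp_id. symmetry; apply comp_idr.
Qed.

Lemma can_at_adjunct (x : Rcom Ω d) (n : Hom Ω A) (g : x ⇒ G n) :
  can_at_cell n ∘ fmap F g
  = ((κ n ∘ fmap F g) ▷ c) ∘ cmod_coact (pushout Ω pq x).
Proof.
  rewrite can_at_counit, wr_comp, !comp_assoc. f_equal.
  apply (pushout_colinear pq g).
Qed.

Lemma can_at_natural (m n : Hom Ω A) (u : m ⇒ n) :
  can_at_cell n ∘ fmap F (fmap G u) = (u ▷ c) ∘ can_at_cell m.
Proof.
  rewrite can_at_adjunct. unfold κ; rewrite counit_at_natural; fold κ.
  now rewrite wr_comp, comp_assoc, <- can_at_counit.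
Qed.

Lemma can_at_eps (n : Hom Ω A) : whisk10 n (cmd_eps c) ∘ can_at_cell n = κ n.
Proof.
  rewrite can_at_counit, <- comp_assoc, whisk10_natural, comp_assoc.
  rewrite <- (comp_idr (κ n)) at 2. f_equal.
  apply (cmod_counit (pushout Ω pq (G n))).
Qed.

Lemma can_at_delta (n : Hom Ω A) :
  whisk12 n (cmd_delta c) ∘ can_at_cell n
  = (can_at_cell n ▷ c) ∘ cmod_coact (pushout Ω pq (G n)).
Proof.
  rewrite can_at_counit, <- comp_assoc, whisk12_natural, wr_comp, !comp_assoc.
  f_equal. symmetry; apply (cmod_coassoc (pushout Ω pq (G n))).
Qed.

Lemma can_at_is_iso (n : Hom Ω A) : is_iso (can_cell pq) -> is_iso (can_at_cell n).
Proof. intros Hcan. now apply whisk31_is_iso. Qed.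

(** Unfolding [λ] gives [Δ_d], then [η], then [can]; the first two form the unit at [G n]. *)
Lemma pair_lambda_can (n : Rcom Ω c) :
  pair_lambda pq n = fmap G (can_at_cell (cmod_cell n)) ∘ θ (G (cmod_cell n)).
Proof.
  apply comodule_hom_eq. simpl. unfold unit_cell, can_at_cell. simpl.
  rewrite lambda_at, beta_at, wr_comp. apply comp_assoc.
Qed.

Lemma adjunct_pair_coact (n : Rcom Ω c) :
  κ (cmod_cell n • c) ∘ fmap F (pair_coact pq n) = cmod_coact n ∘ κ (cmod_cell n).
Proof. apply (counit_at_natural (tensor_adj Ω pq)). Qed.

Lemma adjunct_pair_lambda (n : Rcom Ω c) :
  κ (cmod_cell n • c) ∘ fmap F (pair_lambda pq n) = can_at_cell (cmod_cell n).
Proof.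
  rewrite pair_lambda_can, fmap_comp, <- comp_assoc.
  unfold κ; rewrite counit_at_natural, comp_assoc. unfold θ, F.
  now rewrite triangle_left_at, comp_idr.
Qed.

Lemma can_at_unit (x : Rcom Ω d) :
  can_at_cell (F x) ∘ fmap F (θ x) = cmod_coact (pushout Ω pq x).
Proof.
  rewrite can_at_adjunct. unfold κ, θ, F. rewrite triangle_left_at, hcomp_id.
  apply comp_idl.
Qed.

Lemma pair_coact_pushout (x : Rcom Ω d) :
  pair_coact pq (pushout Ω pq x)
  = fmap G (can_at_cell (F x)) ∘ fmap G (fmap F (θ x)).
Proof. now rewrite <- fmap_comp, can_at_unit. Qed.

Lemma unit_equalizes (x : Rcom Ω d) :
  pair_coact pq (pushout Ω pq x) ∘ θ x = pair_lambda pq (pushout Ω pq x) ∘ θ x.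
Proof.
  rewrite pair_coact_pushout, pair_lambda_can, !comp_assoc. f_equal.
  exact (eq_sym (unit_at_natural (tensor_adj Ω pq) (θ x))).
Qed.

Lemma pair_split_equalizer (n : Rcom Ω c) (k : cmod_cell n • c ⇒ F (G (cmod_cell n))) :
  is_iso (can_cell pq) -> k ∘ can_at_cell (cmod_cell n) = idm _ ->
  can_at_cell (cmod_cell n) ∘ k = idm _ ->
  split_equalizer (fmap F (pair_coact pq n)) (fmap F (pair_lambda pq n))
                  (k ∘ cmod_coact n).
Proof.
  intros Hcan Hk Hk'. split.
  (* After cancelling the isomorphism [n • c • can], the equation becomes coassociativity of [n]. *)
  - apply (is_iso_mono (can_at_is_iso (cmod_cell n • c) Hcan)).
    unfold pair_coact. rewrite <- !(comp_assoc (can_at_cell _)).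
    rewrite can_at_natural, can_at_adjunct, adjunct_pair_lambda.
    change (cmod_coact (pushout Ω pq (tensor_pd Ω pq (cmod_cell n))))
      with (cmod_coact (pushout Ω pq (G (cmod_cell n)))).
    rewrite <- can_at_delta, !comp_assoc, <- !(comp_assoc _ k), Hk', !comp_idl.
    apply cmod_coassoc.
  (* The three relations are, in order, counitality of [n], invertibility of [n • can] and
     naturality of [κ]. *)
  - exists (κ (cmod_cell n)), (k ∘ κ (cmod_cell n • c)). repeat split.
    + rewrite <- can_at_eps, !comp_assoc, <- (comp_assoc _ k), Hk', comp_idl.
      apply cmod_counit.
    + now rewrite comp_assoc, adjunct_pair_lambda.
    + now rewrite !comp_assoc, adjunct_pair_coact.
Qed.

(** * The adjunction between pushout and pullback *)

Context (E : EqualizerCondition Ω pq).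

Definition pullback_arr (n : Rcom Ω c) : pullback E n ⇒ G (cmod_cell n) :=
  equ_arr (E n).

Lemma pullback_arr_equalizes (n : Rcom Ω c) :
  pair_coact pq n ∘ pullback_arr n = pair_lambda pq n ∘ pullback_arr n.
Proof. exact (proj1 (equ_is_equalizer (E n))). Qed.

Lemma pullback_arr_mono (n : Rcom Ω c) (x : Rcom Ω d) (u v : x ⇒ pullback E n) :
  pullback_arr n ∘ u = pullback_arr n ∘ v -> u = v.
Proof. apply equ_arr_mono. Qed.

(** The two sides are the adjuncts of the two arrows of the pair composed with [pullback_arr n]. *)
Lemma pullback_counit_colinear (n : Rcom Ω c) :
  cmod_coact n ∘ (κ (cmod_cell n) ∘ fmap F (pullback_arr n))
  = ((κ (cmod_cell n) ∘ fmap F (pullback_arr n)) ▷ c)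
    ∘ cmod_coact (pushout Ω pq (pullback E n)).
Proof.
  rewrite <- comp_assoc, <- adjunct_pair_coact, comp_assoc, <- fmap_comp.
  rewrite pullback_arr_equalizes, fmap_comp, <- comp_assoc.
  rewrite adjunct_pair_lambda. apply can_at_adjunct.
Qed.

Definition pullback_unit_at (x : Rcom Ω d) : x ⇒ pullback E (pushout Ω pq x) :=
  equ_lift (E (pushout Ω pq x)) (unit_equalizes x).

Lemma pullback_arr_unit (x : Rcom Ω d) :
  pullback_arr (pushout Ω pq x) ∘ pullback_unit_at x = θ x.
Proof. apply equ_lift_arr. Qed.

Lemma pullback_arr_natural (n n' : Rcom Ω c) (φ : n ⇒ n') :
  pullback_arr n' ∘ fmap (pullback E) φ = fmap G (proj1_sig φ) ∘ pullback_arr n.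
Proof. apply equ_lift_arr. Qed.

Definition pullback_counit_at (n : Rcom Ω c) : pushout Ω pq (pullback E n) ⇒ n :=
  exist _ (κ (cmod_cell n) ∘ fmap F (pullback_arr n)) (pullback_counit_colinear n).

Lemma pullback_unit_natural (x y : Rcom Ω d) (f : x ⇒ y) :
  pullback_unit_at y ∘ f
  = fmap (pullback E) (fmap (pushout Ω pq) f) ∘ pullback_unit_at x.
Proof.
  apply pullback_arr_mono. rewrite <- !comp_assoc, pullback_arr_unit.
  rewrite pullback_arr_natural, comp_assoc, pullback_arr_unit.
  apply (unit_at_natural (tensor_adj Ω pq)).
Qed.

Lemma pullback_counit_natural (n n' : Rcom Ω c) (φ : n ⇒ n') :
  pullback_counit_at n' ∘ fmap (pushout Ω pq) (fmap (pullback E) φ)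
  = φ ∘ pullback_counit_at n.
Proof.
  apply comodule_hom_eq.
  change (κ (cmod_cell n') ∘ fmap F (pullback_arr n') ∘ fmap F (fmap (pullback E) φ)
          = proj1_sig φ ∘ (κ (cmod_cell n) ∘ fmap F (pullback_arr n))).
  rewrite comp_assoc, <- fmap_comp, pullback_arr_natural, fmap_comp, <- !comp_assoc.
  f_equal. apply (counit_at_natural (tensor_adj Ω pq)).
Qed.

Lemma pullback_triangle_left (x : Rcom Ω d) :
  pullback_counit_at (pushout Ω pq x) ∘ fmap (pushout Ω pq) (pullback_unit_at x)
  = idm (pushout Ω pq x).
Proof.
  apply comodule_hom_eq.
  change (κ (F x) ∘ fmap F (pullback_arr (pushout Ω pq x))
            ∘ fmap F (pullback_unit_at x) = idm (F x)).
  rewrite comp_assoc, <- fmap_comp, pullback_arr_unit.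
  apply (triangle_left_at (tensor_adj Ω pq)).
Qed.

Lemma pullback_triangle_right (n : Rcom Ω c) :
  fmap (pullback E) (pullback_counit_at n) ∘ pullback_unit_at (pullback E n)
  = idm (pullback E n).
Proof.
  apply pullback_arr_mono. rewrite comp_idr, <- comp_assoc, pullback_arr_natural.
  rewrite comp_assoc, pullback_arr_unit.
  change (fmap G (κ (cmod_cell n) ∘ fmap F (pullback_arr n)) ∘ θ (pullback E n)
          = pullback_arr n).
  rewrite fmap_comp, comp_assoc. unfold θ, F, G at 2.
  rewrite <- unit_at_natural, <- comp_assoc. unfold κ, G.
  now rewrite triangle_right_at, comp_idl.
Qed.

Definition pushout_pullback_adj : Adjunction (pushout Ω pq) (pullback E) :=
  {| adj_unit :=
       {| nt_app := pullback_unit_at : forall x, functor_id _ x ⇒ (_ ∘F _) x;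
          nt_natural := pullback_unit_natural |};
     adj_counit :=
       {| nt_app := pullback_counit_at : forall n, (_ ∘F _) n ⇒ functor_id _ n;
          nt_natural := pullback_counit_natural |};
     adj_triangle_left := pullback_triangle_left;
     adj_triangle_right := pullback_triangle_right |}.

(** * Invertibility of the counit and of the unit *)

Context {X Y : Category}.
Context (H : Functor (Rcom Ω d) X) (H' : Functor (Hom Ω A) Y) (Q' : Functor X Y).

Lemma pullback_counit_is_iso :
  Q' ∘F H = H' ∘F postcomp Ω q ∘F forget Ω d ->
  is_iso (can_cell pq) -> h_separable (tensor_adj Ω pq) H ->
  (forall n : Rcom Ω c,
     is_equalizer (fmap H (pair_coact pq n)) (fmap H (pair_lambda pq n))
                  (fmap H (pullback_arr n))) ->
  reflects_isos H' ->
  forall n, is_iso (pullback_counit_at n).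
Proof.
  intros HQ Hcan Hsep Heq Hrefl n.
  destruct (can_at_is_iso (cmod_cell n) Hcan) as [k [Hk Hk']].
  pose proof (pair_split_equalizer Hcan Hk Hk') as Hsplit.
  apply forget_reflects_isos, Hrefl.
  apply equalizer_comparison_is_iso
    with (f := fmap (H' ∘F F) (pair_coact pq n))
         (g := fmap (H' ∘F F) (pair_lambda pq n))
         (i := fmap (H' ∘F F) (pullback_arr n))
         (i' := fmap H' (k ∘ cmod_coact n)).
  (* The fork is split already under [H], hence remains an equalizer after [Q'], and [HQ] moves it
     to [H' ∘F F]. *)
  - apply (is_equalizer_functor_eq HQ), split_equalizer_is_equalizer.
    apply (split_equalizer_fmap Q').
    exact (h_separable_split_equalizer Hsep Hsplit (Heq n)).
  - apply split_equalizer_is_equalizer, (split_equalizer_fmap H'), Hsplit.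
  (* Colinearity of the counit turns [ρ^n] after it into [n • can] after [fmap F (pullback_arr n)],
     and [k] cancels [n • can]. *)
  - assert (Hcomp : k ∘ cmod_coact n ∘ (κ (cmod_cell n) ∘ fmap F (pullback_arr n))
                    = fmap F (pullback_arr n)).
    { rewrite comp_assoc, pullback_counit_colinear, <- can_at_adjunct.
      rewrite <- comp_assoc, Hk. apply comp_idl. }
    exact (eq_trans (eq_sym (fmap_comp H' _ _)) (f_equal _ Hcomp)).
Qed.

Lemma pullback_unit_is_iso :
  is_iso (can_cell pq) -> h_separable (tensor_adj Ω pq) H ->
  (forall n : Rcom Ω c,
     is_equalizer (fmap H (pair_coact pq n)) (fmap H (pair_lambda pq n))
                  (fmap H (pullback_arr n))) ->
  reflects_isos H ->
  forall x, is_iso (pullback_unit_at x).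
Proof.
  intros Hcan Hsep Heq Hrefl x. apply Hrefl.
  eapply equalizer_comparison_is_iso; [| apply (Heq (pushout Ω pq x)) |].
  (* For [n = x • q] both arrows end with [fmap G (can_at_cell (F x))], whose invertibility leaves
     the equalizer unchanged. *)
  - rewrite pair_coact_pushout, pair_lambda_can, !(fmap_comp H).
    apply is_equalizer_iso_comp.
    + apply is_iso_fmap, is_iso_fmap, can_at_is_iso, Hcan.
    + apply split_equalizer_is_equalizer.
      exact (h_separable_unit_split_equalizer x Hsep).
  - now rewrite <- fmap_comp, pullback_arr_unit.
Qed.

End PushPullAdjunction.

Theorem theorem3p23 (K : TwoCategory) (A B Ω : K)
    (c : Comonad A) (d : Comonad B) (pq : ComonadMorphAdj d c)
    (E : EqualizerCondition Ω pq)
    (X Y : Category)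
    (H : Functor (Rcom Ω d) X) (H' : Functor (Hom Ω A) Y) (Q' : Functor X Y)
    (hQ : Q' ∘F H = H' ∘F forget Ω c ∘F pushout Ω pq)
    (hQ' : H' ∘F forget Ω c ∘F pushout Ω pq
           = H' ∘F postcomp Ω (cma_q pq) ∘F forget Ω d) :
  let conditions1 :=
    is_iso (can_cell pq) /\
    h_separable (tensor_adj Ω pq) H /\
    (forall n : Rcom Ω c,
       is_equalizer (fmap H (pair_coact pq n)) (fmap H (pair_lambda pq n))
                    (fmap H (equ_arr (E n)))) /\
    reflects_isos H' in
  let conditions2 :=
    can_bar_is_iso pq /\ reflects_isos H in
  (conditions1 -> fully_faithful (pullback E)) /\
  (conditions1 -> conditions2 ->
     fully_faithful (pushout Ω pq) /\
     adjoint_equivalence (pushout Ω pq) (pullback E)).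
Proof.
  intros conditions1 conditions2.
  assert (Hcounit : conditions1 ->
            forall n, is_iso (adj_counit (pushout_pullback_adj E) n)).
  { intros [Hcan [Hsep [Heq Hrefl]]].
    exact (pullback_counit_is_iso (eq_trans hQ hQ') Hcan Hsep Heq Hrefl). }
  assert (Hunit : conditions1 -> conditions2 ->
            forall x, is_iso (adj_unit (pushout_pullback_adj E) x)).
  { intros [Hcan [Hsep [Heq _]]] [_ Hrefl].
    exact (pullback_unit_is_iso Hcan Hsep Heq Hrefl). }
  split.
  - intros H1. exact (right_adjoint_fully_faithful (Hcounit H1)).
  - intros H1 H2. split.
    + exact (left_adjoint_fully_faithful (Hunit H1 H2)).
    + exists (pushout_pullback_adj E). auto.
Qed.
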